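(* Let $n\ge 1$ and let $\pi\in\mathcal{S}_n$. Then $\pi$ is block-wise simple in the recursive sense if and only if $\pi$ has no interval of the form $p_1\oplus p_2$ or $p_1\ominus p_2$, i.e. no interval which, as a sequence of entries, is order-isomorphic to $p_1\oplus p_2$ or to $p_1\ominus p_2$ for some non-empty permutations $p_1,p_2$.
   Context: $\mathcal{S}_n$ is the set of permutations of $\{1,\dots,n\}$, written in one-line notation. An interval (or block) of $\pi=a_1\cdots a_n\in\mathcal{S}_n$ is a non-empty contiguous sequence of entries $a_ia_{i+1}\cdots a_{i+k}$ whose values form a set of consecutive integers. The whole permutation and the single entries are intervals (the trivial ones); all other intervals are called proper. A permutation is simple if it has no proper intervals. For $\pi\in\mathcal{S}_m$ and $\sigma\in\mathcal{S}_n$, the direct sum $\pi\oplus\sigma\in\mathcal{S}_{m+n}$ is given by $(\pi\oplus\sigma)_i=\pi_i$ for $i\le m$ and $(\pi\oplus\sigma)_i=\sigma_{i-m}+m$ for $i>m$; the skew sum $\pi\ominus\sigma\in\mathcal{S}_{m+n}$ is given by $(\pi\ominus\sigma)_i=\pi_i+n$ for $i\le m$ and $(\pi\ominus\sigma)_i=\sigma_{i-m}$ for $i>m$. Inflation: for $\sigma\in\mathcal{S}_k$ and $\alpha_i\in\mathcal{S}_{n_i}$ ($n_i\ge1$, $1\le i\le k$), $\sigma[\alpha_1,\dots,\alpha_k]\in\mathcal{S}_{n_1+\cdots+n_k}$ is the permutation obtained by replacing the $i$-th entry of $\sigma$, for each $i$, by a block of $n_i$ consecutive positions and consecutive values that is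 order-isomorphic to $\alpha_i$, the blocks being in the same relative order (in values) as the entries of $\sigma$. Example: $2413[213,21,132,1]=546\,98\,132\,7$. Block-wise simple in the recursive sense: (1) the permutation $1\in\mathcal{S}_1$ is block-wise simple; (2) a permutation $\pi\in\mathcal{S}_n$ is block-wise simple if there are a simple permutation $\sigma\in\mathcal{S}_k$ with $k\ge 4$ and block-wise simple permutations $\alpha_1,\dots,\alpha_k$ such that $\pi=\sigma[\alpha_1,\dots,\alpha_k]$. No other permutations are block-wise simple. *)

(* Defs.v *)
From mathcomp Require Import all_boot all_order all_fingroup.

Set Implicit Arguments.
Unset Strict Implicit.
Unset Printing Implicit Defensive.

(* Permutations of {1, ..., n} are elements of 'S_n, i.e. permutations of
   {0, ..., n-1}: positions and values are both shifted by one. *)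

Definition oneline n (pi : 'S_n) : seq nat :=
  [seq val (pi i) | i <- enum 'I_n].

Definition entries n (pi : 'S_n) (i l : nat) : seq nat :=
  take l (drop i (oneline pi)).

(* The l entries of pi from position i on form an interval.  The bound on i + l
   ensures that there really are l of them. *)
Definition is_interval n (pi : 'S_n) (i l : nat) : Prop :=
  [/\ 0 < l, i + l <= n &
      exists v w, forall x, (x \in entries pi i l) = (v <= x < w)].

Definition simple_perm n (pi : 'S_n) : Prop :=
  ~ exists i l, [/\ is_interval pi i l, l <> 1 & l <> n].

Definition order_iso (s t : seq nat) : Prop :=
  size s = size t /\
  forall a b, a < size s -> b < size s ->
    (nth 0 s a < nth 0 s b) = (nth 0 t a < nth 0 t b).

Section Sums.
Variables (m n : nat) (p : 'S_m) (q : 'S_n).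

Definition dsum_fun (x : 'I_(m + n)) : 'I_(m + n) :=
  match split x with
  | inl i => lshift n (p i)
  | inr j => rshift m (q j)
  end.

Lemma dsum_inj : injective dsum_fun.
Proof.
apply: (can_inj (g := fun y => match split y with
  | inl i => lshift n ((p^-1)%g i) | inr j => rshift m ((q^-1)%g j) end)).
move=> x; rewrite /dsum_fun; case: (splitP x) => j ex.
  rewrite (unsplitK (inl (p j))) permK.
  by apply: val_inj => /=.
rewrite (unsplitK (inr (q j))) permK.
by apply: val_inj => /=.
Qed.

Definition dsum : 'S_(m + n) := perm dsum_inj.

Definition ssum_fun (x : 'I_(m + n)) : 'I_(m + n) :=
  cast_ord (addnC n m)
    match split x with
    | inl i => rshift n (p i)
    | inr j => lshift m (q j)
    end.

Lemma ssum_inj : injective ssum_fun.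
Proof.
move=> x y /cast_ord_inj; rewrite -{2}[x]splitK -{2}[y]splitK.
case: (split x) => i; case: (split y) => j /eqP.
- by rewrite eq_rshift => /eqP/perm_inj->.
- by rewrite eq_rlshift.
- by rewrite eq_lrshift.
- by rewrite eq_lshift => /eqP/perm_inj->.
Qed.

Definition ssum : 'S_(m + n) := perm ssum_inj.

End Sums.

Section Inflation.
Variables (k : nat) (sigma : 'S_k) (n_ : 'I_k -> nat).
Variable alpha : forall i, 'S_(n_ i).

(* tagnat.sig1 x is the block containing position x and tagnat.sig2 x is the
   rank of x inside this block.  Block i takes its values just above those of
   the blocks i' with sigma i' < sigma i. *)
Definition inflate_val (x : 'I_(\sum_i n_ i)) : nat :=
  \sum_(i | sigma i < sigma (tagnat.sig1 x)) n_ i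
  + alpha (tagnat.sig1 x) (tagnat.sig2 x).

Lemma offset_leq i (P : pred 'I_k) :
  (forall j, sigma j <= sigma i -> P j) ->
  \sum_(j | sigma j < sigma i) n_ j + n_ i <= \sum_(j | P j) n_ j.
Proof.
move=> hP; rewrite [leqRHS](bigD1 i) ?hP //= addnC leq_add2l.
rewrite [leqRHS](bigID (fun j => sigma j < sigma i)) /=.
apply: leq_trans (leq_addr _ _); apply/eq_leq/eq_bigl => j.
case: ltnP => lt_ji; rewrite ?andbF // andbT hP 1?ltnW //=.
by apply/esym; apply: contraTneq lt_ji => ->; rewrite ltnn.
Qed.

Lemma inflate_val_lt x : inflate_val x < \sum_i n_ i.
Proof.
apply: leq_trans (@offset_leq (tagnat.sig1 x) predT _) => //.
by rewrite /inflate_val ltn_add2l.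
Qed.

Lemma inflate_val_inj : injective inflate_val.
Proof.
move=> x y; rewrite /inflate_val.
have lt_block u v : sigma (tagnat.sig1 u) < sigma (tagnat.sig1 v) ->
    inflate_val u < inflate_val v.
  move=> lt_uv; rewrite /inflate_val.
  apply: leq_trans (leq_addr _ _).
  apply: leq_trans (@offset_leq (tagnat.sig1 u) _ _).
    by rewrite ltn_add2l.
  by move=> j le_ju; apply: leq_ltn_trans lt_uv.
case: (ltngtP (sigma (tagnat.sig1 x)) (sigma (tagnat.sig1 y))).
- by move/lt_block; rewrite ltn_neqAle => /andP[/eqP].
- by move/lt_block; rewrite ltn_neqAle eq_sym => /andP[/eqP].
move/val_inj/perm_inj => e_xy h; apply: tagnat.sig_inj.
rewrite !tagnat.sigE12; move: (tagnat.sig2 x) (tagnat.sig2 y) h.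
rewrite e_xy => a b /addnI/val_inj/perm_inj ->.
by [].
Qed.

Lemma inflate_inj : injective (fun x => Ordinal (inflate_val_lt x)).
Proof. by move=> x y /(congr1 val)/inflate_val_inj. Qed.

Definition inflate : 'S_(\sum_i n_ i) := perm inflate_inj.

Lemma inflateE i (j : 'I_(n_ i)) (x : 'I_(\sum_i n_ i)) :
  x = \sum_(i' < k | i' < i) n_ i' + j :> nat ->
  inflate x = \sum_(i' | sigma i' < sigma i) n_ i' + alpha i j :> nat.
Proof.
move=> ex; have ->: x = tagnat.Rank i j.
  by apply: val_inj; rewrite /= ex; apply/esym/tagnat.RankEsum.
rewrite permE /= /inflate_val /tagnat.sig2 /tagnat.sig1 tagnat.rankK.
by [].
Qed.

End Inflation.

Inductive blockwise_simple : forall n, 'S_n -> Prop :=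
| blockwise_simple_one : blockwise_simple (1%g : 'S_1)
| blockwise_simple_inflate k (sigma : 'S_k) (n_ : 'I_k -> nat)
    (alpha : forall i, 'S_(n_ i)) :
    4 <= k -> simple_perm sigma -> (forall i, 0 < n_ i) ->
    (forall i, blockwise_simple (alpha i)) ->
    blockwise_simple (inflate sigma alpha).

(* Main.v *)
(* An interval of [sigma[alpha_1, ..., alpha_k]] that meets several blocks
   projects to an interval of the simple permutation [sigma], hence meets all the
   blocks; were it a sum, a cut between its two summands would cut [sigma] into a
   sum as well, and one of the two parts would be a proper interval of [sigma].
   Conversely, if no interval is a sum, cut the permutation greedily from left to
   right into the longest intervals shorter than [n].  An interval of the pattern
   of the blocks is a run of blocks whose union is an interval; as the first block
   of the run is the longest possible one, the run is a single block or everything,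
   so the pattern is simple.  It has length at least 4 because permutations of
   length 2 and 3 are sums. *)
Require Import Defs.
From mathcomp Require Import all_boot all_order all_fingroup.
From mathcomp Require Import zify.

Set Implicit Arguments.
Unset Strict Implicit.
Unset Printing Implicit Defensive.

(** * Intervals and sums for functions on the naturals *)

(** Intervals expressed by comparisons alone, so that the notion applies to a restriction to a block
    without renumbering its values. Being boolean, it lets a longest window be chosen. *)
Definition convex n (f : nat -> nat) i l : bool :=
  [&& 0 < l, i + l <= n &
      [forall x : 'I_n, forall y : 'I_n, forall z : 'I_n,
         [&& i <= x < i + l, i <= y < i + l & f x < f z < f y]
         ==> (i <= z < i + l)]].

Lemma convexP n f i l :
  reflect [/\ 0 < l, i + l <= n &
              forall x y z, i <= x < i + l -> i <= y < i + l -> z < n ->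
                f x < f z < f y -> i <= z < i + l]
          (convex n f i l).
Proof.
apply: (iffP and3P) => -[l_gt0 le_il_n cvx]; split=> //.
  move=> x y z x_in y_in lt_zn fxyz.
  have lt_xn : x < n by lia.
  have lt_yn : y < n by lia.
  have /forallP/(_ (Ordinal lt_yn))/forallP/(_ (Ordinal lt_zn))/implyP :=
    forallP cvx (Ordinal lt_xn).
  by apply; apply/and3P.
apply/forallP => x; apply/forallP => y; apply/forallP => z.
by apply/implyP => /and3P[x_in y_in fxyz]; apply: (cvx x y).
Qed.

Lemma convex_full n f : 0 < n -> convex n f 0 n.
Proof. by move=> n_gt0; apply/convexP; split=> // x y z; lia. Qed.

Lemma convex_single n f i : i < n -> convex n f i 1.
Proof.
move=> lt_in; apply/convexP; split=> // [|x y z x_in y_in _]; first by lia.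
have [-> ->] : x = i /\ y = i by lia.
by lia.
Qed.

(* [b] is [true] for a direct sum and [false] for a skew sum. *)
Definition separated (f : nat -> nat) i j l b :=
  forall x y, i <= x < j -> j <= y < l -> (f x < f y) = b.

(** The order form of an interval that is a sum; [t] is the length of the first summand. *)
Definition decomposable n f :=
  exists i l t b, [/\ convex n f i l, 0 < t < l & separated f i (i + t) (i + l) b].

Definition simple_fun k s := forall i l, convex k s i l -> l = 1 \/ l = k.

Definition injective_below n (f : nat -> nat) :=
  forall x y, x < n -> y < n -> f x = f y -> x = y.

Definition same_order n (f g : nat -> nat) :=
  forall x y, x < n -> y < n -> (f x < f y) = (g x < g y).

(* Block [a] occupies the positions from [P a] to [P a.+1 - 1]. *)
Definition block_quotient n k f s (P : nat -> nat) :=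
  [/\ P 0 = 0, P k = n, forall a, a < k -> P a < P a.+1 &
      forall a b x y, a < k -> b < k -> a <> b ->
        P a <= x < P a.+1 -> P b <= y < P b.+1 -> (f x < f y) = (s a < s b)].

Lemma convex_same_order n f g i l :
  same_order n f g -> convex n f i l -> convex n g i l.
Proof.
move=> fg /convexP[l_gt0 le_n cvx]; apply/convexP; split=> // x y z xi yi zn.
by rewrite -!fg //; try lia; apply: cvx.
Qed.

Lemma decomposable_same_order n f g :
  same_order n f g -> decomposable n f -> decomposable n g.
Proof.
move=> fg [i [l [t [b [cvx lt_tl sep]]]]].
exists i, l, t, b; split=> //; first exact: convex_same_order fg cvx.
move/convexP: cvx => [_ le_n _] x y x_in y_in.
by rewrite -fg ?sep //; lia.
Qed.

(** A value [f y] strictly between [f x] and [f x'] would put [y] inside the window, and injectivity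
    excludes equality. *)
Lemma convex_side n f i l x x' y :
  injective_below n f -> convex n f i l ->
  i <= x < i + l -> i <= x' < i + l -> y < n -> ~~ (i <= y < i + l) ->
  (f x < f y) = (f x' < f y).
Proof.
move=> f_inj /convexP[_ le_n cvx] x_in x'_in lt_yn yNin.
have := cvx x x' y x_in x'_in lt_yn; have := cvx x' x y x'_in x_in lt_yn.
have := f_inj x y; have := f_inj x' y.
by have [//|] := eqVneq (f x) (f y); have [//|] := eqVneq (f x') (f y); lia.
Qed.

(** Both sides of the cut are convex. The left one is proper unless it is a single entry, and then
    the right one has [k - 1 > 1] entries. *)
Lemma separated_not_simple k s u b :
  2 < k -> 0 < u < k -> separated s 0 u k b -> ~ simple_fun k s.
Proof.
move=> k_gt2 u_in sep simple_s.
have [u_gt1|u_le1] := ltnP 1 u.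
  suff /simple_s : convex k s 0 u by lia.
  apply/convexP; split; try lia; move=> x y z x_in y_in lt_zk sxyz.
  have [lt_zu|le_uz] := ltnP z u; first by lia.
  by have := sep x z; have := sep y z; lia.
suff /simple_s : convex k s 1 k.-1 by lia.
apply/convexP; split; try lia; move=> x y z x_in y_in lt_zk sxyz.
have [z0|z_gt0] := posnP z; last by lia.
by have := sep z x; have := sep z y; lia.
Qed.

(** * Cutting positions into consecutive blocks *)

Section Blocks.
Variables (k : nat) (P : nat -> nat).
Hypothesis P_incr : forall a, a < k -> P a < P a.+1.

Lemma cut_leq a b : a <= b <= k -> P a <= P b.
Proof.
elim: b => [|b IHb] /andP[le_ab le_bk]; first by have -> : a = 0 by lia.
have [->//|ne_ab] := eqVneq a b.+1.
by have := P_incr le_bk; have := IHb; lia.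
Qed.

Lemma cut_ltn a b : a < b <= k -> P a < P b.
Proof.
move=> lt_ab; have lt_ak : a < k by lia.
by have := P_incr lt_ak; have := @cut_leq a.+1 b; lia.
Qed.

Lemma cut_block x : P 0 <= x < P k -> exists2 a, a < k & P a <= x < P a.+1.
Proof.
move=> /andP[ge_x0 lt_xk].
have ex_a : exists a, x < P a by exists k.
have [[|a] lt_xa min_a] := ex_minnP ex_a; first by lia.
exists a; first by have := min_a k lt_xk.
by rewrite lt_xa andbT leqNgt; apply/negP => /min_a; rewrite ltnn.
Qed.

End Blocks.

(** A window inside one block is decomposable there after a shift. A window meeting several blocks
    leads to a cut of [s], which [separated_not_simple] forbids. *)
Lemma decomposable_block n k f s P :
  2 < k -> simple_fun k s -> block_quotient n k f s P -> decomposable n f ->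
  exists2 a, a < k & decomposable (P a.+1 - P a) (fun j => f (P a + j)).
Proof.
move=> k_gt2 simple_s [P0 Pk P_incr order] [i [l [t [b [cvx t_in sep]]]]].
have /convexP[l_gt0 le_n cvx'] := cvx.
have P_leq := cut_leq P_incr; have P_ltn := cut_ltn P_incr.
have block x : x < n -> exists2 a, a < k & P a <= x < P a.+1.
  by move=> lt_xn; apply: cut_block => //; rewrite P0 Pk.
have [|a0 a0k a0_in] := block i; first by lia.
have [|a1 a1k a1_in] := block (i + l).-1; first by lia.
have [a01|ne_a01] := eqVneq a0 a1.
  subst a1; exists a0 => //; exists (i - P a0), l, t, b; split=> //.
    apply/convexP; split=> //; first by lia.
    move=> x y z x_in y_in lt_z /= fxyz.
    have := P_leq a0.+1 k.
    by have := cvx' (P a0 + x) (P a0 + y) (P a0 + z); lia.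
  by move=> x y x_in y_in; apply: sep; lia.
have lt_a01 : a0 < a1.
  rewrite ltn_neqAle ne_a01 leqNgt; apply/negP => lt_a10.
  by have := P_leq a1.+1 a0; lia.
(* The larger of [lo] and [P a] lies both in block [a] and in the range from [lo] to [hi - 1]. *)
have rep lo hi a : lo < hi -> a < k -> P a < hi -> lo < P a.+1 ->
    exists2 X, lo <= X < hi & P a <= X < P a.+1.
  by move=> *; exists (maxn lo (P a)); have := P_incr a; lia.
have /simple_s[|a01_full] : convex k s a0 (a1 - a0).+1.
  apply/convexP; split; try lia; move=> x y z x_in y_in lt_zk sxyz.
  have repI a : a0 <= a <= a1 -> exists2 X, i <= X < i + l & P a <= X < P a.+1.
    move=> a_in; apply: rep; try lia.
      by have := P_leq a a1; lia.
    by have := P_leq a0.+1 a.+1; lia.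
  have [|X X_in X_bl] := repI x; first by lia.
  have [|Y Y_in Y_bl] := repI y; first by lia.
  have Pz := P_incr z lt_zk.
  have ne_xz : x <> z by move=> xz; subst z; lia.
  have ne_zy : z <> y by move=> zy; subst z; lia.
  have xz := order x z X (P z); have zy := order z y (P z) Y.
  (* The first position of block [z] has its value between those of [X] and [Y], so it lies in the
     window and [z] lies between [a0] and [a1]. *)
  have Pz_in : i <= P z < i + l.
    by apply: (cvx' X Y) => //; [have := P_ltn z k; lia | rewrite xz ?zy //; lia].
  have [lt_za0|] := ltnP z a0; first by have := P_leq z.+1 a0; lia.
  have [lt_a1z|] := ltnP a1 z; first by have := P_leq a1.+1 z; lia.
  by lia.
- by lia.
have [a00 a1K] : a0 = 0 /\ a1 = k.-1 by lia.
subst a0 a1; rewrite P0 in a0_in; rewrite prednK in a1_in; last by lia.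
have [|c ck c_in] := block (i + t).-1; first by lia.
(* Block [c] contains the last position of the first summand. The blocks up to [c] go to the left of
   the cut [u], unless [c] is the last block, which must go to the right to keep [u < k]. *)
have [u u_in [lt_u ge_u]] : exists2 u, 0 < u < k &
    (forall x, x < u -> P x < i + t) /\
    (forall y, u <= y < k -> i + t < P y.+1).
  have [lt_ck|ge_ck] := ltnP c k.-1.
    exists c.+1; first by lia.
    split=> [x lt_xc|y y_in]; first by have := P_leq x c; lia.
    by have := P_leq c.+1 y; have := P_incr y; lia.
  exists c; first by lia.
  split=> [x lt_xc|y y_in]; first by have := P_leq x c; lia.
  have -> : y.+1 = k by lia.
  by lia.
exfalso; apply: (@separated_not_simple k s u b) => // x y x_in y_in.
have [||||X X_in X_bl] := rep i (i + t) x; try lia.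
- by apply: lt_u; lia.
- by have := P_leq 1 x.+1; lia.
have [||||Y Y_in Y_bl] := rep (i + t) (i + l) y; try lia.
- by have := P_leq y k.-1; lia.
- by apply: ge_u.
by rewrite -(order x y X Y) ?sep //; lia.
Qed.

(** * Greedy cutting into maximal intervals *)

Lemma chain (R : nat -> nat -> Prop) n :
  (forall p, p < n -> exists2 q, p < q <= n & R p q) ->
  exists k P, [/\ P 0 = 0, P k = n, forall a, a < k -> P a < P a.+1 &
                  forall a, a < k -> R (P a) (P a.+1)].
Proof.
move=> step.
suff gen d p : n - p <= d -> p <= n -> exists k P,
    [/\ P 0 = p, P k = n, forall a, a < k -> P a < P a.+1 &
        forall a, a < k -> R (P a) (P a.+1)].
  by apply: (gen n 0); lia.
elim: d p => [|d IHd] p le_d le_pn.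
  by exists 0, (fun=> n); split=> //; lia.
have [lt_pn|le_np] := ltnP p n; last by exists 0, (fun=> n); split=> //; lia.
have [q q_in Rpq] := step p lt_pn.
have [||k [P [P0 Pk P_incr PR]]] := IHd q; try lia.
exists k.+1, (fun a => if a is a'.+1 then P a' else p).
split=> // -[|a] lt_ak; rewrite ?P0 //; first by lia.
- exact: P_incr.
- exact: PR.
Qed.

(** For length 2 the only cut works. Of three distinct values only one is the median, so the first
    or the last entry is extremal and can be cut off. *)
Lemma separated_small k s :
  1 < k < 4 -> injective_below k s ->
  exists u b, 0 < u < k /\ separated s 0 u k b.
Proof.
move=> k_in s_inj.
have s01 := s_inj 0 1; have s02 := s_inj 0 2; have s12 := s_inj 1 2.
have [k2|k3] : k = 2 \/ k = 3 by lia.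
  exists 1, (s 0 < s 1); split=> [|x y x_in y_in]; first by lia.
  by have [-> ->] : x = 0 /\ y = 1 by lia.
have [s0|s0] := boolP ((s 0 < s 1) == (s 0 < s 2)).
  exists 1, (s 0 < s 1); split=> [|x y x_in y_in]; first by lia.
  have [-> [->|->]] : x = 0 /\ (y = 1 \/ y = 2) by lia.
    by [].
  by rewrite (eqP s0).
exists 2, (s 0 < s 2); split=> [|x y x_in y_in]; first by lia.
have [-> [->|->]] : y = 2 /\ (x = 0 \/ x = 1) by lia.
  by [].
by lia.
Qed.

Lemma greedy_blocks n f :
  1 < n -> exists k P,
    [/\ P 0 = 0, P k = n, forall a, a < k -> P a < P a.+1 &
        forall a, a < k ->
          let l := P a.+1 - P a in
          [/\ convex n f (P a) l, l < n &
              forall l', convex n f (P a) l' -> l' < n -> l' <= l]].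
Proof.
move=> n_gt1.
pose R p q := let l := q - p in
  [/\ convex n f p l, l < n & forall l', convex n f p l' -> l' < n -> l' <= l].
apply: (@chain R) => p lt_pn.
(* A single entry is a candidate because [n > 1], so a longest window shorter than [n] starts at
   [p]. *)
have ex_l : exists l, convex n f p l && (l < n).
  by exists 1; rewrite convex_single.
have ub_l l : convex n f p l && (l < n) -> l <= n by lia.
have [l /andP[cvx lt_ln] max_l] := ex_maxnP ex_l ub_l.
have /convexP[l_gt0 le_pl _] := cvx.
exists (p + l); first by lia.
rewrite /R addKn; split=> // l' cvx' lt_l'n.
by apply: max_l; rewrite cvx'.
Qed.

Lemma indecomposable_quotient n f :
  1 < n -> injective_below n f -> ~ decomposable n f ->
  exists k P,
    let s a := f (P a) in
    [/\ 3 < k, injective_below k s, simple_fun k s, block_quotient n k f s P &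
        forall a, a < k -> P a.+1 - P a < n /\
          ~ decomposable (P a.+1 - P a) (fun j => f (P a + j))].
Proof.
move=> n_gt1 f_inj ndec.
have [k [P [P0 Pk P_incr blk]]] := greedy_blocks f n_gt1.
have P_leq := cut_leq P_incr; have P_ltn := cut_ltn P_incr.
have block x : x < n -> exists2 a, a < k & P a <= x < P a.+1.
  by move=> lt_xn; apply: cut_block => //; rewrite P0 Pk.
pose s a := f (P a).
have s_inj : injective_below k s.
  move=> a b lt_ak lt_bk /f_inj eP.
  have := P_ltn a k; have := P_ltn b k; have := P_ltn a b; have := P_ltn b a.
  by lia.
(* Replace [x] by [P a], then [y] by [P b]: each time the other point lies outside the convex block.
   The second comparison is reversed, and injectivity turns it back. *)
have order a b x y : a < k -> b < k -> a <> b ->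
    P a <= x < P a.+1 -> P b <= y < P b.+1 -> (f x < f y) = (s a < s b).
  move=> lt_ak lt_bk ne_ab x_in y_in.
  have [cvxa _ _] := blk a lt_ak; have [cvxb _ _] := blk b lt_bk.
  have := P_incr a lt_ak; have := P_incr b lt_bk => Pb Pa.
  have a_k := P_leq a.+1 k; have b_k := P_leq b.+1 k.
  have ab := P_leq a.+1 b; have ba := P_leq b.+1 a.
  have e1 : (f x < f y) = (f (P a) < f y).
    by apply: (convex_side f_inj cvxa); lia.
  have e2 : (f y < f (P a)) = (f (P b) < f (P a)).
    by apply: (convex_side f_inj cvxb); lia.
  rewrite e1 /s; have := f_inj (P a) y; have := f_inj (P a) (P b).
  by lia.
have quot : block_quotient n k f s P by split.
have k_gt1 : 1 < k.
  case: k => [|[|k]] in Pk blk {P_incr P_leq P_ltn block s_inj order quot} * => //.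
    by lia.
  by have [//|_ + _] := blk 0; lia.
have simple_s : simple_fun k s.
  move=> i l /convexP[l_gt0 le_k cvx].
  have [lt_lk|] := ltnP l k; last by lia.
  left; have lt_ik : i < k by lia.
  have [cvxi lt_n max_i] := blk i lt_ik.
  have Pil := P_ltn i (i + l).
  have Pik := P_leq (i + l) k; have P0i := P_ltn 0 i.
  have Pilk := P_ltn (i + l) k.
  have Pi := P_incr i lt_ik.
  (* The blocks of a convex run of the pattern have a convex union, as comparisons across blocks are
     those of [s]. *)
  have cvxJ : convex n f (P i) (P (i + l) - P i).
    apply/convexP; split; try lia; move=> x y z x_in y_in lt_zn fxyz.
    have [|a ak a_in] := block x; first by lia.
    have [|b bk b_in] := block y; first by lia.
    have [c ck c_in] := block z lt_zn.
    have in_il d u : d < k -> P d <= u < P d.+1 -> P i <= u < P (i + l) ->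
        i <= d < i + l.
      move=> lt_dk u_d u_il.
      by have := P_leq d.+1 i; have := P_leq (i + l) d; lia.
    have a_il : i <= a < i + l by apply: (in_il a x); lia.
    have b_il : i <= b < i + l by apply: (in_il b y); lia.
    suff c_il : i <= c < i + l.
      by have := P_leq c.+1 (i + l); have := P_leq i c; lia.
    have [->//|/eqP ne_ca] := eqVneq c a.
    have [->//|/eqP ne_cb] := eqVneq c b.
    apply: (cvx a b) => //.
    by rewrite -(order a c x z) -?(order c b z y) //; lia.
  (* As [l < k], the union is shorter than [n]. It starts where block [i] starts, so maximality of
     that block forces [l = 1]. *)
  have max_J := max_i _ cvxJ.
  by have := P_ltn i.+1 (i + l); lia.
exists k, P; split=> //.
  (* A pattern of length 2 or 3 would be cut at some [u], and cutting at [P u] would make all of [f]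
     a sum. *)
  rewrite ltnNge; apply/negP => k_le3.
  have [|u [b [u_in sep]]] := @separated_small k s _ s_inj; first by lia.
  have Pu := P_ltn 0 u; have Puk := P_ltn u k.
  apply: ndec; exists 0, n, (P u), b; split; try lia.
    by apply: convex_full; lia.
  move=> x y x_in y_in.
  have [|a ak a_in] := block x; first by lia.
  have [|c ck c_in] := block y; first by lia.
  have lt_au : a < u by have := P_leq u a; lia.
  have le_uc : u <= c by have := P_leq c.+1 u; lia.
  by rewrite (order a c) // ?sep; lia.
move=> a ak; have [cvxa lt_n _] := blk a ak; split=> //.
move=> [i [l [t [b [/convexP[l_gt0 le_l cvx] t_in sep]]]]].
have /convexP[_ _ cvxa'] := cvxa; have Pak := P_leq a.+1 k.
(* A convex window of a convex block is convex in the whole, so a sum inside block [a] would be a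
   sum for [f]. *)
apply: ndec; exists (P a + i), l, t, b; split=> //; last first.
  move=> x y x_in y_in.
  have [xK yK] : P a + (x - P a) = x /\ P a + (y - P a) = y by lia.
  by have := sep (x - P a) (y - P a); rewrite /= xK yK; apply; lia.
apply/convexP; split; try lia; move=> x y z x_in y_in lt_zn fxyz.
have z_in := cvxa' x y z.
have [xK yK] : P a + (x - P a) = x /\ P a + (y - P a) = y by lia.
have zK : P a <= z -> P a + (z - P a) = z by lia.
have := cvx (x - P a) (y - P a) (z - P a); rewrite /= xK yK.
have {}z_in : P a <= z < P a.+1 by lia.
by rewrite zK; lia.
Qed.

(** * Permutations as functions, and standardization *)

Local Notation pv pi := (nth 0 (oneline pi)).

Lemma size_oneline n (pi : 'S_n) : size (oneline pi) = n.
Proof. by rewrite size_map size_enum_ord. Qed.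

Lemma pvE n (pi : 'S_n) (x : 'I_n) : pv pi x = pi x.
Proof. by rewrite (nth_map x) ?size_enum_ord // nth_ord_enum. Qed.

Lemma pv_lt n (pi : 'S_n) x : x < n -> pv pi x < n.
Proof. by move=> lt_xn; rewrite (pvE pi (Ordinal lt_xn)). Qed.

Lemma pv_inj n (pi : 'S_n) : injective_below n (pv pi).
Proof.
move=> x y lt_xn lt_yn.
rewrite (pvE pi (Ordinal lt_xn)) (pvE pi (Ordinal lt_yn)).
by move=> /val_inj/perm_inj[].
Qed.

Lemma pv_surj n (pi : 'S_n) v : v < n -> exists2 x, x < n & pv pi x = v.
Proof.
move=> lt_vn; exists ((pi^-1)%g (Ordinal lt_vn)) => //.
by rewrite pvE permKV.
Qed.

(** A value of a permutation equals the number of values below it, so the relative order determines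
    the permutation. *)
Lemma perm_eq_same_order n (p q : 'S_n) : same_order n (pv p) (pv q) -> p = q.
Proof.
have rank (r : 'S_n) x : val (r x) = #|[set y | r y < r x]|.
  have -> : [set y | r y < r x] = r @^-1: [set z : 'I_n | z < r x].
    by apply/setP => y; rewrite !inE.
  rewrite card_preimset; last exact: perm_inj.
  rewrite -sum1_card (eq_bigl (fun z : 'I_n => z < r x)).
    by rewrite (big_ord_narrow (ltnW (ltn_ord (r x)))) sum1_card card_ord.
  by move=> z; rewrite inE.
move=> pq; apply/permP => x; apply: val_inj; rewrite (rank p) (rank q).
by congr #|pred_of_set _|; apply/setP => y; rewrite !inE -!pvE pq.
Qed.

(** Each position is sent to the number of positions with smaller [f]; this rank is strictly
    increasing in [f], and injectivity of [f] makes it a permutation. *)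
Lemma standardize m f :
  injective_below m f -> exists s : 'S_m, same_order m (pv s) f.
Proof.
move=> f_inj; pose below (x : 'I_m) := [set y : 'I_m | f y < f x].
have below_lt x : #|below x| < m.
  rewrite -[X in _ < X]card_ord; apply: proper_card; apply/properP; split.
    by apply/subsetP.
  by exists x; rewrite ?inE ?ltnn.
have below_mono (x y : 'I_m) : f x < f y -> #|below x| < #|below y|.
  move=> fxy; apply: proper_card; apply/properP; split.
    by apply/subsetP => z; rewrite !inE => /ltn_trans; apply.
  by exists x; rewrite inE ?ltnn.
have s_inj : injective (fun x => Ordinal (below_lt x)).
  move=> x y /(congr1 val) /= e; apply/val_inj/f_inj => //=.
  by have [fxy|fyx|//] := ltngtP (f x) (f y);
    [have := below_mono x y fxy | have := below_mono y x fyx]; rewrite e ltnn.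
exists (perm s_inj) => x y lt_xm lt_ym.
rewrite (pvE _ (Ordinal lt_xm)) (pvE _ (Ordinal lt_ym)) !permE /=.
have := below_mono (Ordinal lt_xm) (Ordinal lt_ym).
have := below_mono (Ordinal lt_ym) (Ordinal lt_xm).
have [fxy|fyx|/f_inj e] /= := ltngtP (f x) (f y); try lia.
move: (e lt_xm lt_ym) => {}e; subst y; rewrite (bool_irrelevance lt_ym lt_xm).
by rewrite ltnn.
Qed.

(** * Inflations as block quotients *)

Lemma block_quotient_same_order n k f g s P :
  block_quotient n k f s P -> block_quotient n k g s P ->
  (forall a, a < k ->
     same_order (P a.+1 - P a) (fun j => f (P a + j)) (fun j => g (P a + j))) ->
  same_order n f g.
Proof.
move=> [P0 Pk P_incr f_order] [_ _ _ g_order] fg x y lt_xn lt_yn.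
have block u : u < n -> exists2 a, a < k & P a <= u < P a.+1.
  by move=> lt_un; apply: cut_block => //; rewrite P0 Pk.
have [a ak a_in] := block x lt_xn; have [b bk b_in] := block y lt_yn.
have [e|/eqP ne_ab] := eqVneq a b; last by rewrite (f_order a b) ?(g_order a b).
subst b; have [xK yK] : P a + (x - P a) = x /\ P a + (y - P a) = y by lia.
by have := fg a ak (x - P a) (y - P a); rewrite /= xK yK; apply; lia.
Qed.

(** [P b] sums the lengths of the blocks before [b]. The values of block [a] start at [off a], and
    [offset_leq] keeps the value ranges disjoint and ordered as in [sigma]. *)
Lemma inflate_block_quotient k (sigma : 'S_k) (n_ : 'I_k -> nat)
    (alpha : forall i, 'S_(n_ i)) :
  (forall i, 0 < n_ i) ->
  exists P, block_quotient (\sum_i n_ i) k (pv (inflate sigma alpha)) (pv sigma) P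
    /\ forall a : 'I_k, P a.+1 = P a + n_ a /\
         same_order (n_ a) (fun j => pv (inflate sigma alpha) (P a + j))
                    (pv (alpha a)).
Proof.
move=> n_gt0; pose P b := \sum_(i < k | i < b) n_ i.
have PS (a : 'I_k) : P a.+1 = P a + n_ a.
  rewrite /P (bigD1 a) //= addnC; congr (_ + _); apply: eq_bigl => i.
  by rewrite -(inj_eq val_inj) /=; lia.
have P_le_n b : P b <= P k.
  rewrite [P k](bigID (fun i : 'I_k => i < b)) /=.
  apply: leq_trans (leq_addr _ _); apply: eq_leq.
  by apply: eq_bigl => i; rewrite ltn_ord.
have Pk : P k = \sum_i n_ i by apply: eq_bigl => i; rewrite ltn_ord.
pose off (a : 'I_k) := \sum_(i | sigma i < sigma a) n_ i.
have val_inflate (a : 'I_k) (j : 'I_(n_ a)) :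
    pv (inflate sigma alpha) (P a + j) = off a + alpha a j.
  have lt_n : P a + j < \sum_i n_ i.
    by rewrite -Pk; apply: leq_trans (P_le_n a.+1); rewrite PS ltn_add2l.
  by rewrite (pvE _ (Ordinal lt_n)) (inflateE sigma alpha (i := a) (j := j)).
have lt_inflate (a b : 'I_k) i j : i < n_ a -> j < n_ b -> sigma a < sigma b ->
    pv (inflate sigma alpha) (P a + i) < pv (inflate sigma alpha) (P b + j).
  move=> lt_i lt_j lt_ab.
  rewrite (val_inflate a (Ordinal lt_i)) (val_inflate b (Ordinal lt_j)).
  apply: leq_trans (leq_addr _ _).
  apply: leq_trans (@offset_leq _ sigma n_ a _ _); first by rewrite ltn_add2l.
  by move=> c le_ca; apply: leq_ltn_trans lt_ab.
exists P; split; last first.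
  move=> a; split=> // x y lt_x lt_y /=.
  rewrite (val_inflate a (Ordinal lt_x)) (val_inflate a (Ordinal lt_y)).
  by rewrite ltn_add2l -!pvE.
split=> //; first by rewrite /P big_pred0.
  by move=> a lt_ak; rewrite (PS (Ordinal lt_ak)) -{1}[P a]addn0 ltn_add2l.
move=> a b x y lt_ak lt_bk ne_ab.
rewrite (PS (Ordinal lt_ak)) (PS (Ordinal lt_bk)) /= => x_in y_in.
have := lt_inflate (Ordinal lt_ak) (Ordinal lt_bk) (x - P a) (y - P b).
have := lt_inflate (Ordinal lt_bk) (Ordinal lt_ak) (y - P b) (x - P a).
rewrite /= !subnKC; try lia.
rewrite -!pvE /=; have := @pv_inj _ sigma a b; lia.
Qed.

(** * Intervals, simplicity and sums of permutations *)

(** In one direction injectivity recovers a position from its value. In the other the bounds are the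
    extreme entries: each value between them occurs somewhere in [pi], and convexity places it in
    the window. *)
Lemma is_interval_convex n (pi : 'S_n) i l :
  is_interval pi i l <-> convex n (pv pi) i l.
Proof.
have mem_entries x : i + l <= n ->
    (x \in entries pi i l) <-> exists2 j, i <= j < i + l & pv pi j = x.
  move=> le_n; have sz : size (entries pi i l) = l.
    by rewrite size_takel // size_drop size_oneline; lia.
  split=> [/(nthP 0)[j] | [j j_in <-]].
    rewrite sz => lt_jl <-; exists (i + j); first by lia.
    by rewrite nth_take // nth_drop.
  apply/(nthP 0); exists (j - i); first by rewrite sz; lia.
  by rewrite nth_take ?nth_drop; [congr nth; lia | lia].
split=> [[l_gt0 le_n [v [w vw]]] | /convexP[l_gt0 le_n cvx]].
  have in_vw j : i <= j < i + l -> v <= pv pi j < w.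
    by move=> j_in; rewrite -vw; apply/mem_entries => //; exists j.
  apply/convexP; split=> // x y z /in_vw x_in /in_vw y_in lt_zn fxyz.
  have : v <= pv pi z < w by lia.
  rewrite -vw => /(mem_entries _ le_n)[j j_in ej].
  by have <- : j = z by apply: (pv_inj (pi := pi)) => //; lia.
split=> //.
have ex_v : exists v, v \in entries pi i l.
  by exists (pv pi i); apply/mem_entries => //; exists i => //; lia.
have ub_v v : v \in entries pi i l -> v <= n.
  by move=> /(mem_entries _ le_n)[j j_in <-]; apply/ltnW/pv_lt; lia.
have [lo lo_in min_lo] := ex_minnP ex_v.
have [hi hi_in max_hi] := ex_maxnP ex_v ub_v.
exists lo, hi.+1 => x; rewrite ltnS; apply/idP/idP.
  by move=> x_in; rewrite min_lo // max_hi.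
have /(mem_entries _ le_n)[a a_in ea] := lo_in.
have /(mem_entries _ le_n)[b b_in eb] := hi_in.
have [->//|/eqP ne_x_lo] := eqVneq x lo.
have [->//|/eqP ne_x_hi] := eqVneq x hi.
move=> x_in; have [|z lt_zn ez] := @pv_surj n pi x.
  by have := @pv_lt n pi b; lia.
apply/mem_entries => //; exists z => //.
by apply: (cvx a b) => //; rewrite ea eb ez; lia.
Qed.

Lemma simple_perm_simple_fun k (sigma : 'S_k) :
  simple_perm sigma <-> simple_fun k (pv sigma).
Proof.
split=> [simple_s i l cvx | simple_s [i [l [/is_interval_convex/simple_s]]]].
  have [//|/eqP ne_l1] := eqVneq l 1; first by left.
  have [//|/eqP ne_lk] := eqVneq l k; first by right.
  by case: simple_s; exists i, l; split=> //; apply/is_interval_convex.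
by case.
Qed.

Lemma nth_dsum m n (p : 'S_m) (q : 'S_n) a : a < m + n ->
  pv (dsum p q) a = if a < m then pv p a else m + pv q (a - m).
Proof.
move=> lt_a; rewrite (pvE _ (Ordinal lt_a)) permE /dsum_fun.
case: splitP => [i|j] /= ->; first by rewrite ltn_ord pvE.
by rewrite ltnNge leq_addr /= addKn pvE.
Qed.

Lemma nth_ssum m n (p : 'S_m) (q : 'S_n) a : a < m + n ->
  pv (ssum p q) a = if a < m then n + pv p a else pv q (a - m).
Proof.
move=> lt_a; rewrite (pvE _ (Ordinal lt_a)) permE /ssum_fun.
case: splitP => [i|j] /= ->; first by rewrite ltn_ord pvE.
by rewrite ltnNge leq_addr /= addKn pvE.
Qed.

(** From left to right the cut comes after the [m1] entries of [p1]. From right to left [p1] and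
    [p2] are the standardizations of the two parts. *)
Lemma decomposableP n (pi : 'S_n) :
  (exists i l : nat, is_interval pi i l /\
      exists (m1 m2 : nat) (p1 : 'S_m1) (p2 : 'S_m2),
        [/\ 0 < m1, 0 < m2 &
            order_iso (entries pi i l) (oneline (dsum p1 p2)) \/
            order_iso (entries pi i l) (oneline (ssum p1 p2))])
  <-> decomposable n (pv pi).
Proof.
have sz i l : i + l <= n -> size (entries pi i l) = l.
  by move=> le_n; rewrite size_takel // size_drop size_oneline; lia.
have nth_entries i l a : a < l -> nth 0 (entries pi i l) a = pv pi (i + a).
  by move=> lt_al; rewrite nth_take // nth_drop.
split.
  move=> [i [l [I [m1 [m2 [p1 [p2 [m1_gt0 m2_gt0 iso]]]]]]]].
  have [l_gt0 le_n _] := I.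
  have el : l = m1 + m2.
    by case: iso => -[]; rewrite sz // size_oneline.
  have lt1 x : x < m1 -> pv p1 x < m1 by apply: pv_lt.
  have lt2 x : x < m2 -> pv p2 x < m2 by apply: pv_lt.
  have [b iso_b] : exists b, forall x y, x < m1 -> m1 <= y < l ->
      (nth 0 (entries pi i l) x < nth 0 (entries pi i l) y) = b.
    case: iso => -[_ iso]; [exists true | exists false] => x y lt_x y_in.
      rewrite iso ?sz ?nth_dsum; try lia.
      have [-> ->] : (x < m1) = true /\ (y < m1) = false by lia.
      by have := lt1 x; lia.
    rewrite iso ?sz ?nth_ssum; try lia.
    have [-> ->] : (x < m1) = true /\ (y < m1) = false by lia.
    by have := lt2 (y - m1); lia.
  exists i, l, m1, b; split; [exact/is_interval_convex | by lia |].
  move=> x y x_in y_in; have := iso_b (x - i) (y - i).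
  by rewrite !nth_entries ?subnKC; try lia; apply; lia.
move=> [i [l [t [b [cvx t_in sep]]]]].
have /convexP[l_gt0 le_n _] := cvx.
have inj_from u m : u + m <= n -> injective_below m (fun x => pv pi (u + x)).
  by move=> le_um x y lt_x lt_y /pv_inj; lia.
have [|p1 p1E] := @standardize t (fun x => pv pi (i + x)).
  by apply: inj_from; lia.
have [|p2 p2E] := @standardize (l - t) (fun x => pv pi (i + t + x)).
  by apply: inj_from; lia.
exists i, l; split; first exact/is_interval_convex.
exists t, (l - t), p1, p2; split; try lia.
have iso g : size g = l ->
    (forall x y, x < l -> y < l ->
       (pv pi (i + x) < pv pi (i + y)) = (nth 0 g x < nth 0 g y)) ->
    order_iso (entries pi i l) g.
  move=> szg order; split; first by rewrite sz.
  by move=> x y; rewrite sz // => lt_x lt_y; rewrite !nth_entries // order.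
have sz12 : t + (l - t) = l by lia.
have low x y : x < t -> y < t ->
    (pv pi (i + x) < pv pi (i + y)) = (pv p1 x < pv p1 y) by move=> *; rewrite p1E.
have high x y : t <= x < l -> t <= y < l ->
    (pv pi (i + x) < pv pi (i + y)) = (pv p2 (x - t) < pv p2 (y - t)).
  move=> x_in y_in; rewrite p2E; try lia.
  by have [-> ->] : i + t + (x - t) = i + x /\ i + t + (y - t) = i + y by lia.
have cross x y : x < t -> t <= y < l -> (pv pi (i + x) < pv pi (i + y)) = b.
  by move=> lt_x y_in; apply: sep; lia.
have cross' x y : x < t -> t <= y < l -> (pv pi (i + y) < pv pi (i + x)) = ~~ b.
  move=> lt_x y_in; have := cross x y lt_x y_in.
  by have := @pv_inj n pi (i + x) (i + y); lia.
have lt1 x : x < t -> pv p1 x < t by apply: pv_lt.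
have lt2 x : t <= x < l -> pv p2 (x - t) < l - t by move=> x_in; apply: pv_lt; lia.
case: b sep cross cross' => _ cross cross'; [left | right].
all: apply: iso; rewrite ?size_oneline // => x y lt_x lt_y.
  rewrite !nth_dsum ?sz12 //.
  have [lt_xt|le_tx] := ltnP x t; have [lt_yt|le_ty] := ltnP y t.
  - exact: low.
  - by rewrite cross ?lt_xt ?le_ty //; have := lt1 x; lia.
  - by rewrite cross' ?lt_yt ?le_tx //; have := lt1 y; lia.
  - by rewrite ltn_add2l high ?le_tx ?le_ty.
rewrite !nth_ssum ?sz12 //.
have [lt_xt|le_tx] := ltnP x t; have [lt_yt|le_ty] := ltnP y t.
- by rewrite ltn_add2l low.
- by rewrite cross ?lt_xt ?le_ty //; have := lt2 y; lia.
- by rewrite cross' ?lt_yt ?le_tx //; have := lt2 x; lia.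
- by rewrite high ?le_tx ?le_ty.
Qed.

(** * The two implications *)

(** [pi] and [inflate sigma alpha] have the same cuts, pattern and order inside blocks, hence are
    equal. *)
Lemma blockwise_simple_of_quotient n (pi : 'S_n) k (sigma : 'S_k) P :
  3 < k -> simple_perm sigma -> block_quotient n k (pv pi) (pv sigma) P ->
  (forall a : 'I_k, exists alpha : 'S_(P a.+1 - P a), blockwise_simple alpha /\
     same_order (P a.+1 - P a) (pv alpha) (fun j => pv pi (P a + j))) ->
  blockwise_simple pi.
Proof.
move=> k_gt3 simple_s quot /fin_all_exists[alpha alphaP].
have [P0 Pk P_incr _] := quot.
pose n_ (a : 'I_k) := P a.+1 - P a.
have n_gt0 a : 0 < n_ a by rewrite subn_gt0 P_incr.
have [Q [quotQ blkQ]] := inflate_block_quotient sigma alpha n_gt0.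
have [Q0 Qk _ _] := quotQ.
have QP a : a <= k -> Q a = P a.
  elim: a => [|a IHa] le_ak; first by rewrite Q0 P0.
  have [/= eQ _] := blkQ (Ordinal le_ak).
  by rewrite eQ (IHa (ltnW le_ak)) subnKC // ltnW // P_incr.
have en : n = \sum_a n_ a by rewrite -Qk QP // Pk.
(* The length [n] and the sum of the [n_ a] are equal but not convertible, so the inflation is
   generalized to a [rho] of length [N] before [N] is substituted. *)
suff gen N (e : n = N) (rho : 'S_N) :
    block_quotient N k (pv rho) (pv sigma) Q ->
    (forall a : 'I_k,
       same_order (n_ a) (fun j => pv rho (Q a + j)) (pv (alpha a))) ->
    blockwise_simple rho -> blockwise_simple pi.
  apply: (gen _ en) quotQ _ _ => [a|]; first by case: (blkQ a).
  by apply: blockwise_simple_inflate => // a; case: (alphaP a).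
subst N => quot_rho blk_rho; suff -> : pi = rho by [].
apply: perm_eq_same_order; apply: (block_quotient_same_order quot).
  have [_ _ _ order] := quot_rho.
  split=> // a b x y ak bk ne_ab; rewrite -!QP; try lia.
  exact: order.
move=> a ak x y lt_x lt_y.
have [_ pi_alpha] := alphaP (Ordinal ak).
have := blk_rho (Ordinal ak) x y lt_x lt_y; rewrite /= QP; last by lia.
by move=> ->; rewrite pi_alpha.
Qed.

(** Induction on the construction: a single entry leaves no room for a cut, and a sum inside an
    inflation passes down to one of its blocks. *)
Lemma blockwise_simple_indecomposable n (pi : 'S_n) :
  blockwise_simple pi -> ~ decomposable n (pv pi).
Proof.
elim=> {n pi} [|k sigma n_ alpha k_ge4 simple_s n_gt0 _ IH].
  by move=> [i [l [t [b [/convexP[_ le_1 _] t_in _]]]]]; lia.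
have [P [quot blk]] := inflate_block_quotient sigma alpha n_gt0.
move=> /(decomposable_block _ _ quot)[||a ak].
- by lia.
- exact/simple_perm_simple_fun.
have [-> order] := blk (Ordinal ak); rewrite addKn.
by move=> /(decomposable_same_order order)/IH.
Qed.

(** Strong induction on [n]: the standardized blocks are shorter than [n] and inherit
    indecomposability. *)
Lemma indecomposable_blockwise_simple n (pi : 'S_n) :
  0 < n -> ~ decomposable n (pv pi) -> blockwise_simple pi.
Proof.
elim/ltn_ind: n pi => n IH pi n_gt0 ndec.
have [n_gt1|n_le1] := ltnP 1 n; last first.
  have e1 : n = 1 by lia.
  subst n; suff -> : pi = 1%g by constructor.
  by apply/permP => x; rewrite !ord1.
have pi_inj := @pv_inj n pi.
have [k [P [k_gt3 s_inj simple_s [P0 Pk P_incr order] blk]]] :=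
  indecomposable_quotient n_gt1 pi_inj ndec.
have [sigma sigmaE] := standardize s_inj.
apply: (@blockwise_simple_of_quotient n pi k sigma P) => //.
- apply/simple_perm_simple_fun => i l cvx.
  exact/simple_s/(convex_same_order sigmaE cvx).
- by split=> // a b x y ak bk ne_ab x_in y_in; rewrite sigmaE // (order a b).
move=> a; have [lt_n nda] := blk a (ltn_ord a).
have [|alpha alphaE] := @standardize (P a.+1 - P a) (fun j => pv pi (P a + j)).
  have := cut_leq P_incr (a := a.+1) (b := k); have := ltn_ord a.
  by move=> ak le_k x y lt_x lt_y /pi_inj; lia.
exists alpha; split=> //; apply: IH => //; first by rewrite subn_gt0 P_incr.
by move=> /(decomposable_same_order alphaE).
Qed.

Theorem theorem3p2 (n : nat) (pi : 'S_n) (hn : 1 <= n) :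
  blockwise_simple pi <->
  ~ exists i l : nat, is_interval pi i l /\
      exists (m1 m2 : nat) (p1 : 'S_m1) (p2 : 'S_m2),
        [/\ 0 < m1, 0 < m2 &
            order_iso (entries pi i l) (oneline (dsum p1 p2)) \/
            order_iso (entries pi i l) (oneline (ssum p1 p2))].
Proof.
split=> [/blockwise_simple_indecomposable ndec /decomposableP // | ndec].
apply: indecomposable_blockwise_simple => // dec.
exact/ndec/decomposableP.
Qed.
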